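(* Let $P$ and $Q$ be probability measures on a measurable space $\mathcal{X}$, let $Q = Q_a + Q_s$ be the Lebesgue decomposition of $Q$ with respect to $P$ ($Q_a \ll P$, $Q_s \perp P$), and let $U : [0,\infty] \to [-\infty,\infty]$ be measurable. Let $\varepsilon^*$ be a $U$-optimal e-value for $H=\{P\}$. - Strict monotonicity. If $U$ is strictly increasing and $Q_a(\mathcal{X})>0$, then $\mathrm{E}^P[\varepsilon^*]=1$. - Uniqueness. If $U$ is strictly concave, then the $U$-optimal e-value is unique up to $Q_a$-almost sure equality. - Positivity. If $U(0)=-\infty$, then $\varepsilon^*>0$, $Q_a$-almost surely.
   Context: Notation: $\mathrm{E}^\mu[f]=\int f\,d\mu$ for any nonnegative measure $\mu$. Strict monotonicity and strict concavity of $U$ are understood on $[0,\infty)$ (valid e-values are finite $P$-a.s., hence $Q_a$-a.s., so $U(\infty)$ is immaterial). An e-value is a measurable map $\varepsilon:\mathcal{X}\to[0,\infty]$; it is valid for the simple hypothesis $H=\{P\}$ if $\mathrm{E}^P[\varepsilon]\le 1$. A valid e-value $\varepsilon^*$ is $U$-optimal (against $Q_a$) if, for every valid e-value $\varepsilon$, $\mathrm{E}^{Q_a}[U(\varepsilon^* )-U(\varepsilon)]$ is well-defined and $\geq 0$. Here ''well-defined'' means that the integrand avoids an ambiguous $\infty-\infty$ $Q_a$-almost surely, and that its positive part or its negative part has finite $Q_a$-expectation. *)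

(* Defs.v *)
From HB Require Import structures.
From mathcomp Require Import all_boot all_order all_algebra.
From mathcomp Require Import all_classical all_reals all_analysis.
From mathcomp Require Import measurable_realfun.

Set Implicit Arguments.
Unset Strict Implicit.
Unset Printing Implicit Defensive.

Import Order.TTheory GRing.Theory Num.Theory.
Import numFieldNormedType.Exports.

Local Open Scope classical_set_scope.
Local Open Scope ring_scope.
Local Open Scope ereal_scope.

Section defs.
Context d (T : measurableType d) (R : realType).

Definition mutually_singular (mu nu : set T -> \bar R) : Prop :=
  exists N : set T, [/\ measurable N, mu N = 0 & nu (~` N) = 0].

Definition lebesgue_decomposition (P Q Qa Qs : set T -> \bar R) : Prop :=
  [/\ forall A, measurable A -> Q A = Qa A + Qs A,
      Qa `<< P & mutually_singular Qs P].

Definition evalue (eps : T -> \bar R) : Prop :=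
  measurable_fun setT eps /\ forall x, 0 <= eps x.

Definition valid_evalue (P : set T -> \bar R) (eps : T -> \bar R) : Prop :=
  evalue eps /\ \int[P]_x eps x <= 1.

(* The difference f - g is never of the form oo - oo, almost surely, and its
   positive or its negative part has a finite integral. *)
Definition well_defined_diff (mu : {measure set T -> \bar R})
    (f g : T -> \bar R) : Prop :=
  {ae mu, forall x, f x +? - g x} /\
  (\int[mu]_x (f \- g)^\+ x < +oo \/ \int[mu]_x (f \- g)^\- x < +oo).

Definition U_optimal (P : set T -> \bar R) (Qa : {measure set T -> \bar R})
    (U : \bar R -> \bar R) (eps : T -> \bar R) : Prop :=
  valid_evalue P eps /\
  forall eps', valid_evalue P eps' ->
    well_defined_diff Qa (U \o eps) (U \o eps') /\
    0 <= \int[Qa]_x (U (eps x) - U (eps' x)).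

(* A utility [0, oo] -> [-oo, oo] is a map on \bar R whose values at negative
   arguments are never used. *)
Definition measurable_utility (U : \bar R -> \bar R) : Prop :=
  measurable_fun [set x : \bar R | 0 <= x] U.

Definition strictly_increasing (U : \bar R -> \bar R) : Prop :=
  forall x y : R, (0 <= x)%R -> (x < y)%R -> U x%:E < U y%:E.

(* The right-hand side may be the ambiguous sum (+oo) + (-oo), which the
   library evaluates to -oo. This has no effect on the notion: whether the
   inequality is imposed or waived in that case, it forces U < +oo on
   [0, oo[. *)
Definition strictly_concave (U : \bar R -> \bar R) : Prop :=
  forall x y t : R, (0 <= x)%R -> (0 <= y)%R -> x != y -> (0 < t < 1)%R ->
    U (t * x + (1 - t) * y)%:E > t%:E * U x%:E + (1 - t)%:E * U y%:E.

End defs.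

(* Main.v *)
Require Import Defs.
From HB Require Import structures.
From mathcomp Require Import all_boot all_order all_algebra.
From mathcomp Require Import all_classical all_reals all_analysis.
From mathcomp Require Import measurable_realfun.
From mathcomp Require Import lra.

Import Order.TTheory GRing.Theory Num.Theory.
Import numFieldNormedType.Exports.

Local Open Scope classical_set_scope.
Local Open Scope ring_scope.
Local Open Scope ereal_scope.

(** An optimal [eps] loses no expected [Qa]-utility against any valid e-value;
each claim follows from one well-chosen competitor.

Monotonicity. If [E^P[eps] < 1], the slack [delta] can be added to [eps]
while keeping it valid. Valid e-values are finite [P]-a.s., hence [Qa]-a.s.
([valid_evalue_ae_fin_num]), so the gain in utility is strict [Qa]-a.s.;
optimality makes it vanish [Qa]-a.s. ([ae_eq0_of_le0_integral_ge0]), which is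
only possible if [Qa] is null.

Uniqueness. Let [eps] and [eps'] be optimal and let [m] be their midpoint,
with utilities [f], [g] and [h]. Optimality gives [0 <= E(f - h)] and
[0 <= E(g - h)], whereas concavity gives [(f - h) + (g - h) <= 0] a.s.,
strictly where [eps != eps']. Comparing with the midpoint on both sides keeps
the argument symmetric and makes integrability automatic: each difference has
an integrable negative part because its integral is nonnegative, and its
positive part is dominated by the negative part of the other. Hence the sum
vanishes a.s. ([ae_eq_opp_of_integral_ge0]) and so [eps = eps'] a.s.

Positivity. An infinite utility cannot be subtracted from itself, so the
well-definedness of the comparison of [eps] with itself already says that
[U(eps)] is finite [Qa]-a.s. ([U_optimal_ae_fin_num]). This excludes
[eps = 0] when [U 0 = -oo], and it also provides the finiteness used for
uniqueness. *)

Section integrals.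
Context d (T : measurableType d) (R : realType).
Variable mu : {measure set T -> \bar R}.
Implicit Types f g : T -> \bar R.

Lemma ae_eq0_of_le0_integral_ge0 f : measurable_fun setT f ->
  {ae mu, forall x, f x <= 0} -> 0 <= \int[mu]_x f x ->
  {ae mu, forall x, f x = 0}.
Proof.
move=> mf f0 If.
have mabs : measurable_fun setT (fun x => `|f x|) by exact: measurableT_comp.
have fE : \int[mu]_x f x = - \int[mu]_x `|f x|.
  rewrite -integral_ge0N //; apply: ae_eq_integral => //.
    exact: measurableT_comp.
  by apply: filterS f0 => x fx0 _; rewrite (lee0_abs fx0) oppeK.
have /(ae_eq_integral_abs mu measurableT mf) : \int[mu]_x `|f x| = 0.
  by apply/eqP; rewrite eq_le integral_ge0// andbT -oppe_ge0 -fE.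
by apply: filterS => x; exact.
Qed.

(** The integral is the difference of the integrals of the two parts, and
[oo - oo] evaluates to [-oo]; so an infinite negative part always makes the
integral [-oo]. *)
Lemma integral_funeneg_lty f : 0 <= \int[mu]_x f x ->
  \int[mu]_x f^\- x < +oo.
Proof.
rewrite integralE ltey; apply: contraTneq => ->.
by rewrite addeNy.
Qed.

(** No integrability is assumed: the negative parts of [f] and [g] are
integrable because both integrals are nonnegative, and [f <= - g] bounds the
positive part of [f] by the negative part of [g]. *)
Lemma integrable_of_le_opp f g :
  measurable_fun setT f -> measurable_fun setT g ->
  0 <= \int[mu]_x f x -> 0 <= \int[mu]_x g x ->
  {ae mu, forall x, f x <= - g x} -> mu.-integrable setT f.
Proof.
move=> mf mg /integral_funeneg_lty fn /integral_funeneg_lty gn fg.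
apply/integrableP; split=> //.
rewrite -/(abse \o f) fune_abse.
rewrite ge0_integralD//; [|exact: measurable_funepos|exact: measurable_funeneg].
apply: lte_add_pinfty => //; apply: le_lt_trans gn.
apply: ae_ge0_le_integral => //.
- exact: measurable_funepos.
- exact: measurable_funeneg.
apply: filterS fg => x fgx _.
by rewrite funeposE funenegE ge_max !le_max fgx lexx orbT.
Qed.

(** The hypothesis [f <= - g] is symmetric in [f] and [g], so both are
integrable; their sum is a.s. nonpositive with a nonnegative integral, hence
a.s. zero. *)
Lemma ae_eq_opp_of_integral_ge0 f g :
  measurable_fun setT f -> measurable_fun setT g ->
  0 <= \int[mu]_x f x -> 0 <= \int[mu]_x g x ->
  {ae mu, forall x, f x <= - g x} -> {ae mu, forall x, f x = - g x}.
Proof.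
move=> mf mg If Ig fg.
have intf : mu.-integrable setT f by exact: (integrable_of_le_opp _ g).
have intg : mu.-integrable setT g.
  apply: (integrable_of_le_opp _ f) => //.
  by apply: filterS fg => x; rewrite leeNr.
have sum0 : {ae mu, forall x, f x + g x = 0}.
  apply: ae_eq0_of_le0_integral_ge0.
  - exact: emeasurable_funD.
  - apply: filterS fg => x /=.
    case: (f x) (g x) => [a| |] [b| |] //=; rewrite ?addeNy ?addNye ?leNye//.
    by rewrite -EFinD !lee_fin; lra.
  - have -> : \int[mu]_x (f x + g x) = \int[mu]_x f x + \int[mu]_x g x.
      exact: integralD.
    exact: adde_ge0.
apply: filterS sum0 => x.
by case: (f x) (g x) => [a| |] [b| |] //= [] ab; congr EFin; lra.
Qed.

End integrals.

Section evalues.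
Set Implicit Arguments.
Unset Strict Implicit.
Context d (X : measurableType d) (R : realType).
Variables (P : probability X R) (Qa : {measure set X -> \bar R}).
Implicit Types (eps : X -> \bar R) (U : \bar R -> \bar R).

Lemma measurable_utility_comp U eps : measurable_utility U -> evalue eps ->
  measurable_fun setT (U \o eps).
Proof.
move=> mU [meps eps0]; apply: (measurable_comp _ _ mU meps).
- have -> : [set x : \bar R | 0 <= x] = [set` `[0, +oo[%O].
    by apply/seteqP; split=> x /=; rewrite in_itv/= andbT.
  exact: emeasurable_itv.
- by move=> _ [x _ <-] /=.
Qed.

Lemma valid_evalue_ae_fin_num eps : Qa `<< P -> valid_evalue P eps ->
  {ae Qa, forall x, eps x \is a fin_num}.
Proof.
move=> QaP [[meps eps0] eps1].
have : P.-integrable setT eps.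
  apply/integrableP; split=> //.
  under eq_integral do rewrite gee0_abs//.
  exact: le_lt_trans eps1 (ltry _).
move/(integrable_ae measurableT) => [N [mN PN NS]].
exists N; split=> //; first exact: (null_content_dominatesP _ _).1 PN.
by move=> x /= nfin; apply: NS => /= /(_ I).
Qed.

Lemma valid_evalue_convex (t : R) eps eps' : (0 <= t <= 1)%R ->
  valid_evalue P eps -> valid_evalue P eps' ->
  valid_evalue P (fun x => t%:E * eps x + (1 - t)%:E * eps' x).
Proof.
move=> /andP[t0 t1] [[m e0] e1] [[m' e0'] e1'].
have s0 : (0 <= 1 - t)%R by rewrite subr_ge0.
split; first split.
- by apply: emeasurable_funD; exact: measurable_funeM.
- by move=> x; rewrite adde_ge0// mule_ge0.
rewrite ge0_integralD//; first last.
- exact: measurable_funeM.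
- by move=> x _; rewrite mule_ge0.
- exact: measurable_funeM.
- by move=> x _; rewrite mule_ge0.
rewrite !ge0_integralZl//.
apply: (@le_trans _ _ (t%:E * 1 + (1 - t)%:E * 1)).
  by rewrite leeD// lee_wpmul2l.
by rewrite !mule1 -EFinD lee_fin; lra.
Qed.

Lemma valid_evalue_slack (delta : R) eps : (0 <= delta)%R ->
  valid_evalue P eps -> \int[P]_x eps x + delta%:E <= 1 ->
  valid_evalue P (fun x => eps x + delta%:E).
Proof.
move=> delta0 [[m e0] e1] le1; split; first split.
- exact: emeasurable_funD.
- by move=> x; rewrite adde_ge0.
rewrite ge0_integralD// integral_cst// [X in _ * X]probability_setT.
by rewrite mule1.
Qed.

(** Subtracting an infinite value from itself is ambiguous, and optimality
includes the comparison of an optimal e-value with itself. *)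
Lemma U_optimal_ae_fin_num U eps : U_optimal P Qa U eps ->
  {ae Qa, forall x, U (eps x) \is a fin_num}.
Proof.
move=> [veps /(_ _ veps)[[+ _] _]].
by apply: filterS => x /=; case: (U (eps x)).
Qed.

(** The slack [1 - E^P[eps]] is added to [eps] everywhere. This is a strict
improvement wherever [eps] is finite, since strict monotonicity speaks of
finite arguments only. *)
Lemma U_optimal_integral1 U eps : Qa `<< P -> measurable_utility U ->
  U_optimal P Qa U eps -> strictly_increasing U -> 0 < Qa setT ->
  \int[P]_x eps x = 1.
Proof.
move=> QaP mU [veps opt] incU Qa0.
have [[_ eps0] le1] := veps.
apply/eqP; rewrite eq_le le1/= leNgt; apply/negP => lt1.
have ffin : \int[P]_x eps x \is a fin_num.
  by rewrite ge0_fin_numE ?integral_ge0// (lt_trans lt1)// ltry.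
pose delta := (1 - fine (\int[P]_x eps x))%R.
have delta0 : (0 < delta)%R by rewrite subr_gt0 -lte_fin fineK.
have veps' : valid_evalue P (fun x => eps x + delta%:E).
  apply: valid_evalue_slack => //; first exact: ltW.
  by rewrite -[X in X + _](fineK ffin) -EFinD lee_fin /delta; lra.
have [_ gain] := opt _ veps'.
have loss : {ae Qa, forall x, U (eps x) - U (eps x + delta%:E) < 0}.
  apply: filterS (valid_evalue_ae_fin_num QaP veps) => x.
  case: (eps x) (eps0 x) => // r r0 _.
  have : U r%:E < U (r%:E + delta%:E).
    by rewrite -EFinD; apply: incU => //; rewrite ltrDl.
  case: (U r%:E) (U (r%:E + delta%:E)) => [a| |] [b| |] //=;
    rewrite ?addeNy ?addNye ?ltNye//.
  by rewrite -EFinD !lte_fin; lra.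
have noloss : {ae Qa, forall x, U (eps x) - U (eps x + delta%:E) = 0}.
  apply: ae_eq0_of_le0_integral_ge0 => //.
    apply: emeasurable_funB; apply: measurable_utility_comp => //.
    - exact: veps.1.
    - exact: veps'.1.
  by apply: filterS loss => x /ltW.
have [N [mN QN NS]] : {ae Qa, forall x, False}.
  by apply: filterS2 loss noloss => x + eq0; rewrite eq0 ltxx.
have NT : N = setT by apply/seteqP; split=> // x _; exact: NS.
by move: Qa0; rewrite -NT QN ltxx.
Qed.

(** The midpoint is compared with both optima. Each optimum has at least its
expected utility, but wherever the optima differ the utility of the midpoint
is above the average of theirs; so they can differ on a null set only. *)
Lemma U_optimal_unique U eps eps' : Qa `<< P -> measurable_utility U ->
  strictly_concave U -> U_optimal P Qa U eps -> U_optimal P Qa U eps' ->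
  {ae Qa, forall x, eps x = eps' x}.
Proof.
move=> QaP mU ccU opt opt'.
have [veps best] := opt; have [veps' best'] := opt'.
have half : (0 <= (2^-1 : R) <= 1)%R by apply/andP; split; lra.
pose m x := (2^-1)%:E * eps x + (1 - 2^-1)%:E * eps' x.
have vm : valid_evalue P m by exact: valid_evalue_convex.
have [_ If] := best _ vm; have [_ Ig] := best' _ vm.
have mf : measurable_fun setT (fun x => U (eps x) - U (m x)).
  apply: emeasurable_funB; apply: measurable_utility_comp => //.
  - exact: veps.1.
  - exact: vm.1.
have mg : measurable_fun setT (fun x => U (eps' x) - U (m x)).
  apply: emeasurable_funB; apply: measurable_utility_comp => //.
  - exact: veps'.1.
  - exact: vm.1.
(* This is strict concavity at [t = 1/2], written as an inequality between the
   two differences so that the a.s. finiteness of the outer utilities suffices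
   for the rearrangement. *)
have lt_mid : {ae Qa, forall x, eps x != eps' x ->
    U (eps x) - U (m x) < - (U (eps' x) - U (m x))}.
  apply: filterS2 (filterI (valid_evalue_ae_fin_num QaP veps)
      (valid_evalue_ae_fin_num QaP veps'))
    (filterI (U_optimal_ae_fin_num opt) (U_optimal_ae_fin_num opt')).
  move=> x /= []; rewrite /m.
  case: (eps x) (veps.1.2 x) => // a a0 _.
  case: (eps' x) (veps'.1.2 x) => // b b0 _.
  move=> [Ua Ub] ab.
  have halfs : (0 < (2^-1 : R) < 1)%R by apply/andP; split; lra.
  have := ccU a b 2^-1%R a0 b0 ab halfs.
  case: (U a%:E) Ua => // p _; case: (U b%:E) Ub => // q _.
  rewrite -!EFinM -!EFinD.
  by case: (U _) => [c| |] //=; rewrite !lte_fin; lra.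
(* Where the optima agree, the midpoint is their common value and both
   differences vanish. *)
have eq_mid : {ae Qa, forall x,
    U (eps x) - U (m x) = - (U (eps' x) - U (m x))}.
  apply: ae_eq_opp_of_integral_ge0 => //.
  apply: filterS3 lt_mid (valid_evalue_ae_fin_num QaP veps)
    (U_optimal_ae_fin_num opt) => x lt_x epsx Ux.
  have [eq_x|/lt_x/ltW //] := eqVneq (eps x) (eps' x).
  have -> : m x = eps x.
    rewrite /m -eq_x -(fineK epsx) -!EFinM -EFinD; congr EFin; lra.
  by rewrite -eq_x subee// oppe0.
apply: filterS2 lt_mid eq_mid => x lt_x eq_x.
by apply/eqP; apply: contraT => /lt_x; rewrite eq_x ltxx.
Qed.

Lemma U_optimal_gt0 U eps : U 0 = -oo -> U_optimal P Qa U eps ->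
  {ae Qa, forall x, 0 < eps x}.
Proof.
move=> U0 opt; apply: filterS (U_optimal_ae_fin_num opt) => x.
rewrite lt0e opt.1.1.2 andbT; apply: contraTneq => ->.
by rewrite U0.
Qed.

End evalues.

Theorem proposition4 (R : realType) (d : measure_display)
    (X : measurableType d) (P Q : probability X R)
    (Qa Qs : {measure set X -> \bar R})
    (hQ : lebesgue_decomposition P Q Qa Qs)
    (U : \bar R -> \bar R) (hU : measurable_utility U)
    (eps : X -> \bar R) (heps : U_optimal P Qa U eps) :
  [/\ strictly_increasing U -> 0 < Qa setT -> \int[P]_x eps x = 1,
      strictly_concave U ->
        forall eps' : X -> \bar R, U_optimal P Qa U eps' ->
          {ae Qa, forall x, eps x = eps' x}
    & U 0 = -oo -> {ae Qa, forall x, 0 < eps x}].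
Proof.
have [_ QaP _] := hQ; split.
- by move=> incU Qa0; exact: (U_optimal_integral1 QaP hU heps).
- by move=> ccU eps' heps'; exact: (U_optimal_unique QaP hU ccU).
- by move=> U0; exact: (U_optimal_gt0 U0 heps).
Qed.
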